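(* Let $n \ge 0$ be an integer, let $a<b$ be real numbers, and let $f$ be a real-valued function that has an $(n+1)$th derivative in $[a,b]$. Let $m, M \in \mathbb{R}$ be such that $m \le f^{(n+1)}(x) \le M$ for every $a < x < b$. Then for every $x$ with $a \le x \le b$, $$\frac{m}{(n+1)!}(x-a)^{n+1} \le R_n(x) \le \frac{M}{(n+1)!}(x-a)^{n+1},$$ where $R_n = f - P_n$ is the remainder of the Taylor polynomial $P_n$ of order $n$ of $f$ at $a$.
   Context: The Taylor polynomial of order $n$ of $f$ at $a$ is $$P_n(x) = f(a) + f'(a)(x-a) + \cdots + \frac{f^{(n)}(a)}{n!}(x-a)^n,$$ and the remainder term is $R_n(x) = f(x) - P_n(x)$. Having an $(n+1)$th derivative in $[a,b]$ means that $f$ is $(n+1)$ times differentiable at every point of the closed interval $[a,b]$, with derivatives at the endpoints understood as one-sided derivatives relative to $[a,b]$. No continuity of $f^{(n+1)}$ is assumed. *)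

(* Defs.v *)
From Stdlib Require Import Reals Lra Factorial ClassicalEpsilon.
Open Scope R_scope.

Definition Icc (a b x : R) : Prop := a <= x <= b.

(* Derivatives are taken relative to a set D, through the library's [D_in]
   (difference quotients over y in D, y <> x).  For D = Icc a b this is the
   one-sided derivative at a and at b, and the ordinary one in between; the
   values of f outside [a, b] play no role. *)
Definition is_derive_within (D : R -> Prop) (f : R -> R) (x l : R) : Prop :=
  D_in f (fun _ => l) D x.

Definition ex_derive_within (D : R -> Prop) (f : R -> R) (x : R) : Prop :=
  exists l : R, is_derive_within D f x l.

(* The derivative as a total operator: its value is arbitrary at the points
   where the derivative does not exist. *)
Definition Derive_within (D : R -> Prop) (f : R -> R) (x : R) : R :=
  epsilon (inhabits 0) (is_derive_within D f x).

Fixpoint Derive_n_within (D : R -> Prop) (f : R -> R) (k : nat) : R -> R :=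
  match k with
  | O => f
  | S k' => Derive_within D (Derive_n_within D f k')
  end.

(* f is k times differentiable at every point of D. *)
Definition has_derive_n_within (D : R -> Prop) (f : R -> R) (k : nat) : Prop :=
  forall j : nat, (j < k)%nat ->
  forall x : R, D x -> ex_derive_within D (Derive_n_within D f j) x.

(* [sum_f_R0 _ n] has the n + 1 terms of index 0, ..., n. *)
Definition taylor_poly (D : R -> Prop) (f : R -> R) (a : R) (n : nat) (x : R)
  : R :=
  sum_f_R0 (fun k => Derive_n_within D f k a / INR (fact k) * (x - a) ^ k) n.

Definition taylor_remainder (D : R -> Prop) (f : R -> R) (a : R) (n : nat)
  (x : R) : R :=
  f x - taylor_poly D f a n x.

Lemma Derive_within_correct (D : R -> Prop) (f : R -> R) (x : R) :
  ex_derive_within D f x -> is_derive_within D f x (Derive_within D f x).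
Proof. exact (epsilon_spec (inhabits 0) (is_derive_within D f x)). Qed.

Lemma is_derive_within_Icc_unique (a b : R) (f : R -> R) (x l : R) :
  a < b -> Icc a b x -> is_derive_within (Icc a b) f x l ->
  Derive_within (Icc a b) f x = l.
Proof.
intros Hab Hx Hl.
assert (Hd : is_derive_within (Icc a b) f x (Derive_within (Icc a b) f x)).
{ apply Derive_within_correct. now exists l. }
refine (single_limit _ _ _ _ x _ Hd Hl).
intros e He; unfold D_x, Icc, Rdist in *.
destruct (Rlt_le_dec x b) as [Hxb | Hxb].
- pose proof (Rmin_l (e / 2) (b - x)); pose proof (Rmin_r (e / 2) (b - x)).
  assert (0 < Rmin (e / 2) (b - x)) by (apply Rmin_glb_lt; lra).
  exists (x + Rmin (e / 2) (b - x)).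
  rewrite Rabs_pos_eq; lra.
- pose proof (Rmin_l (e / 2) (x - a)); pose proof (Rmin_r (e / 2) (x - a)).
  assert (0 < Rmin (e / 2) (x - a)) by (apply Rmin_glb_lt; lra).
  exists (x - Rmin (e / 2) (x - a)).
  rewrite Rabs_left; lra.
Qed.

(* Main.v *)
Require Import Defs.
From Stdlib Require Import Reals Factorial.
From Stdlib Require Import Lra Lia Arith.
Open Scope R_scope.

(* The inequality holds for any chain g 0, g 1, ..., each the derivative of
   the preceding one, by induction on its length: the shifted chain bounds g 1
   by the derivative of the polynomial that is to bound g 0, and by the mean
   value theorem the bound passes from the derivatives to the functions.
   The lower bound is the upper bound for - f. *)

(* Composing with the projection onto [a, b] turns derivatives and continuity
   within [a, b] into the two-sided ones that the library's MVT asks for. *)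
Definition clamp (a b x : R) : R := Rmax a (Rmin x b).

Lemma clamp_in (a b x : R) : a <= b -> Icc a b (clamp a b x).
Proof.
intros Hab; unfold Icc, clamp, Rmax, Rmin.
destruct (Rle_dec x b); destruct (Rle_dec a _); lra.
Qed.

Lemma clamp_id (a b x : R) : Icc a b x -> clamp a b x = x.
Proof.
unfold Icc, clamp; intros Hx.
rewrite Rmin_left by lra; apply Rmax_right; lra.
Qed.

Lemma clamp_lipschitz (a b x y : R) :
  a <= b -> Rabs (clamp a b x - clamp a b y) <= Rabs (x - y).
Proof.
intros Hab; unfold clamp, Rmax, Rmin.
destruct (Rle_dec x b), (Rle_dec y b); repeat destruct (Rle_dec a _);
  unfold Rabs; repeat destruct (Rcase_abs _); lra.
Qed.

(** Since [clamp] fixes x and does not increase distances, points near x go to points of [a, b] at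
    least as near. This covers the endpoints too, where the mean value theorem asks for
    continuity. *)
Lemma is_derive_within_clamp_continuity (a b : R) (f : R -> R) (x l : R) :
  a <= b -> Icc a b x -> is_derive_within (Icc a b) f x l ->
  continuity_pt (fun y => f (clamp a b y)) x.
Proof.
intros Hab Hx Hl e He.
destruct (cont_deriv _ _ _ _ Hl e He) as [d [Hd H]].
exists d; split; [exact Hd |].
simpl in *; unfold Rdist in *; intros y [_ Hy].
rewrite (clamp_id a b x Hx).
(* The limit [H] is over points other than x, but [clamp] may send y to x itself. *)
destruct (Req_dec x (clamp a b y)) as [<- | Hne].
{ now rewrite Rminus_diag, Rabs_R0. }
apply H; split; [split; [now apply clamp_in | exact Hne] |].
pose proof (clamp_lipschitz a b y x Hab) as Hlip.
rewrite (clamp_id a b x Hx) in Hlip; lra.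
Qed.

Lemma is_derive_within_clamp_derivable (a b : R) (f : R -> R) (x l : R) :
  a < x < b -> is_derive_within (Icc a b) f x l ->
  derivable_pt_lim (fun y => f (clamp a b y)) x l.
Proof.
intros Hx Hl e He.
destruct (Hl e He) as [d [Hd H]].
(* Within this radius x + h stays in [a, b], where [clamp] is the identity. *)
assert (Hr : 0 < Rmin d (Rmin (x - a) (b - x)))
  by (repeat apply Rmin_glb_lt; lra).
exists (mkposreal _ Hr); simpl; intros h Hh0 Hh.
apply Rmin_Rgt_l in Hh as [Hhd Hh]; apply Rmin_Rgt_l in Hh as [Hha Hhb].
apply Rgt_lt in Hhd, Hha, Hhb.
apply Rabs_def2 in Hha; apply Rabs_def2 in Hhb.
rewrite !clamp_id by (unfold Icc; lra).
simpl in H; unfold Rdist in H.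
replace h with (x + h - x) at 2 by ring.
apply H; unfold D_x, Icc.
repeat split; try lra.
now replace (x + h - x) with h by ring.
Qed.

Lemma derive_within_nonpos_le (a b : R) (h dh : R -> R) :
  (forall x, Icc a b x -> is_derive_within (Icc a b) h x (dh x)) ->
  (forall x, a < x < b -> dh x <= 0) ->
  forall x, Icc a b x -> h x <= h a.
Proof.
intros Hd Hneg x Hx.
destruct (Req_dec x a) as [-> | Hxa]; [lra |].
assert (Hax : a < x) by (unfold Icc in Hx; lra).
assert (Hxb : x <= b) by apply Hx.
assert (Hlim : forall y, a < y < x ->
  derivable_pt_lim (fun z => h (clamp a b z)) y (dh y)).
{ intros y Hy; apply is_derive_within_clamp_derivable; [lra |].
  apply Hd; unfold Icc; lra. }
(* [MVT] is Cauchy's two-function form; taking [id] as the second function gives Lagrange's. *)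
destruct (MVT (fun y => h (clamp a b y)) id a x
            (fun y Hy => exist _ (dh y) (Hlim y Hy))
            (fun y _ => derivable_pt_id y) Hax) as [y [Hy Heq]].
- intros y Hy.
  apply (is_derive_within_clamp_continuity a b h y (dh y)); [lra | |];
    [| apply Hd]; unfold Icc; lra.
- intros y _; apply derivable_continuous_pt, derivable_pt_id.
- rewrite (derive_pt_eq_0 id y 1) in Heq by apply derivable_pt_lim_id.
  rewrite (derive_pt_eq_0 _ y (dh y)) in Heq by apply Hlim, Hy.
  rewrite !clamp_id in Heq by (unfold Icc; lra).
  unfold id in Heq.
  assert (dh y <= 0) by (apply Hneg; lra).
  nra.
Qed.

Lemma derivable_pt_lim_is_derive_within (D : R -> Prop) (f : R -> R)
  (x l : R) : derivable_pt_lim f x l -> is_derive_within D f x l.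
Proof.
intros H e He.
destruct (H e He) as [d Hd].
exists d; split; [apply cond_pos |].
simpl; unfold Rdist; intros y [[_ Hne] Hy].
specialize (Hd (y - x)).
replace (x + (y - x)) with y in Hd by ring.
apply Hd; [lra | exact Hy].
Qed.

(** Dividing by factorials makes differentiation a mere shift of [c]: the factor k + 1 cancels
    against (k + 1)!. *)
Lemma derivable_pt_lim_taylor_sum (c : nat -> R) (a : R) (n : nat) (x : R) :
  derivable_pt_lim
    (fun y => sum_f_R0 (fun k => c k / INR (fact k) * (y - a) ^ k) (S n)) x
    (sum_f_R0 (fun k => c (S k) / INR (fact k) * (x - a) ^ k) n).
Proof.
assert (Hs := derivable_pt_lim_fs (fun k => c k / INR (fact k)) (x - a) (S n)
                (Nat.lt_0_succ n)).
assert (Ht : derivable_pt_lim (fun y => y - a) x (1 - 0)).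
{ apply derivable_pt_lim_minus;
    [apply derivable_pt_lim_id | apply derivable_pt_lim_const]. }
assert (Hc := derivable_pt_lim_comp _ _ _ _ _ Ht Hs).
simpl pred in Hc.
replace (sum_f_R0 _ n) with
  (sum_f_R0 (fun k => INR (S k) * (c (S k) / INR (fact (S k))) * (x - a) ^ k) n
     * (1 - 0)); [exact Hc |].
rewrite Rminus_0_r, Rmult_1_r; apply sum_eq; intros k _.
rewrite fact_simpl, mult_INR.
field; split; [apply INR_fact_neq_0 | apply not_0_INR; lia].
Qed.

(** The difference of f and the polynomial has a nonpositive derivative inside the interval, so it
    never exceeds its value at a, which is f a - c 0 <= 0. *)
Lemma taylor_bound_integrate (a b : R) (f df : R -> R) (c : nat -> R)
  (n : nat) :
  (forall x, Icc a b x -> is_derive_within (Icc a b) f x (df x)) ->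
  f a <= c O ->
  (forall x, a < x < b ->
     df x <= sum_f_R0 (fun k => c (S k) / INR (fact k) * (x - a) ^ k) n) ->
  forall x, Icc a b x ->
    f x <= sum_f_R0 (fun k => c k / INR (fact k) * (x - a) ^ k) (S n).
Proof.
intros Hd Hc Hle x Hx.
set (p := fun y => sum_f_R0 (fun k => c k / INR (fact k) * (y - a) ^ k) (S n)).
set (dp := fun y => sum_f_R0 (fun k => c (S k) / INR (fact k) * (y - a) ^ k) n).
assert (Hpa : p a = c O).
(* Every term after the constant one contains the factor a - a. *)
{ unfold p; rewrite decomp_sum by lia.
  rewrite (sum_eq _ (fun _ => 0)), sum_cte.
  - simpl; field.
  - intros i _; simpl; rewrite Rminus_diag; ring. }
assert (Hx' : f x - p x <= f a - p a).
{ apply (derive_within_nonpos_le a b (fun y => f y - p y)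
           (fun y => df y - dp y)); [| | exact Hx].
  - intros y Hy.
    exact (Dminus _ (fun _ => df y) (fun _ => dp y) f p y (Hd y Hy)
             (derivable_pt_lim_is_derive_within _ _ _ _
                (derivable_pt_lim_taylor_sum c a n y))).
  - intros y Hy; specialize (Hle y Hy); fold (dp y) in Hle; lra. }
fold (p x); lra.
Qed.

(** The coefficients are free upper bounds, so that the top one can bound the last derivative on the
    open interval while the others bound values at a. Induction needs [g] and [c] general, as both
    get shifted. *)
Lemma taylor_chain_le (n : nat) (a b : R) (g : nat -> R -> R) (c : nat -> R) :
  (forall j, (j <= n)%nat -> forall x, Icc a b x ->
     is_derive_within (Icc a b) (g j) x (g (S j) x)) ->
  (forall j, (j <= n)%nat -> g j a <= c j) ->
  (forall x, a < x < b -> g (S n) x <= c (S n)) ->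
  forall x, Icc a b x ->
    g O x <= sum_f_R0 (fun k => c k / INR (fact k) * (x - a) ^ k) (S n).
Proof.
revert g c; induction n as [| n IH]; intros g c Hg Hc Hlast;
  (apply (taylor_bound_integrate a b (g 0%nat) (g 1%nat));
    [apply Hg; lia | apply Hc; lia | intros x Hx]).
- specialize (Hlast x Hx); simpl; lra.
- apply (IH (fun j => g (S j)) (fun j => c (S j)));
    [intros; apply Hg; [lia | easy] | intros; apply Hc; lia | exact Hlast
    | unfold Icc; lra].
Qed.

Lemma taylor_chain_remainder_le (n : nat) (a b : R) (g : nat -> R -> R)
  (M : R) :
  (forall j, (j <= n)%nat -> forall x, Icc a b x ->
     is_derive_within (Icc a b) (g j) x (g (S j) x)) ->
  (forall x, a < x < b -> g (S n) x <= M) ->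
  forall x, Icc a b x ->
    g O x - sum_f_R0 (fun k => g k a / INR (fact k) * (x - a) ^ k) n
      <= M / INR (fact (S n)) * (x - a) ^ (S n).
Proof.
intros Hg HM x Hx.
(* Taylor coefficients up to order n, then the bound [M] in place of the value of the last
   derivative at a. *)
pose (c := fun k => if Nat.eq_dec k (S n) then M else g k a).
assert (HcM : c (S n) = M)
  by (unfold c; destruct (Nat.eq_dec _ _); [reflexivity | lia]).
assert (Hcg : forall k, (k <= n)%nat -> c k = g k a)
  by (intros k Hk; unfold c; destruct (Nat.eq_dec _ _); [lia | reflexivity]).
assert (H : g O x <=
  sum_f_R0 (fun k => c k / INR (fact k) * (x - a) ^ k) (S n)).
{ apply (taylor_chain_le n a b); [exact Hg | | | exact Hx].
  - intros j Hj; rewrite Hcg by exact Hj; lra.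
  - now rewrite HcM. }
rewrite tech5, HcM in H.
rewrite (sum_eq _ (fun k => g k a / INR (fact k) * (x - a) ^ k)) in H
  by (intros k Hk; now rewrite Hcg).
lra.
Qed.

Theorem theorem3 (n : nat) (a b : R) (f : R -> R) (m M : R)
  (hab : a < b)
  (hf : has_derive_n_within (Icc a b) f (S n))
  (hmM : forall x : R, a < x < b ->
         m <= Derive_n_within (Icc a b) f (S n) x <= M) :
  forall x : R, a <= x <= b ->
    m / INR (fact (S n)) * (x - a) ^ (S n)
      <= taylor_remainder (Icc a b) f a n x
      <= M / INR (fact (S n)) * (x - a) ^ (S n).
Proof.
intros x Hx.
set (g := Derive_n_within (Icc a b) f).
assert (Hg : forall j, (j <= n)%nat -> forall y, Icc a b y ->
  is_derive_within (Icc a b) (g j) y (g (S j) y)).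
{ intros j Hj y Hy; apply Derive_within_correct, hf; [lia | exact Hy]. }
unfold taylor_remainder, taylor_poly.
split.
- assert (H := taylor_chain_remainder_le n a b (fun j y => - g j y) (- m)).
  specialize (H (fun j Hj y Hy => Dopp _ _ _ _ (Hg j Hj y Hy))).
  assert (Hm : forall y, a < y < b -> - g (S n) y <= - m)
    by (intros y Hy; apply Ropp_le_contravar, hmM, Hy).
  specialize (H Hm x Hx); cbv beta in H.
  (* The sign is moved to the right of each term, the form in which [scal_sum] pulls out a
     constant. *)
  rewrite (sum_eq _ (fun k => g k a / INR (fact k) * (x - a) ^ k * -1)),
    <- scal_sum in H by (intros; field; apply INR_fact_neq_0).
  replace (- m / INR (fact (S n)) * (x - a) ^ S n)
    with (- (m / INR (fact (S n)) * (x - a) ^ S n)) in H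
    by (field; apply INR_fact_neq_0).
  fold g; change (f x) with (g O x); lra.
- apply (taylor_chain_remainder_le n a b g M Hg); [| exact Hx].
  intros y Hy; apply hmM, Hy.
Qed.
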